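(* Let $W=\langle a\rangle\wr\langle t\rangle$ be the wreath product of two infinite cyclic groups. For each integer $l\ge1$ let $w_l=[\dots[[a,t],t],\dots,t]$ be the $(l-1)$-fold commutator, i.e. $w_1=a$ and $w_{l}=[w_{l-1},t]$ for $l\ge2$, and let $H_l=W/\langle\langle w_l\rangle\rangle_W$. Then \[\tilde\delta_{H_l}(n)\succcurlyeq n^l.\]
   Context: Conventions: $[x,y]=x^{-1}y^{-1}xy$; $\langle\langle S\rangle\rangle_W$ is the normal closure of $S$ in $W$; $A\wr T=\bigl(\bigoplus_{t\in T}A^t\bigr)\rtimes T$ with $T$ permuting the copies of $A$ by translation. Relative Dehn function: let $\mathcal S_2$ be the variety of metabelian groups and $\tilde F(X)$ the free metabelian group on a finite set $X$ (the free group on $X$ modulo its second derived subgroup). A finite relative presentation $\mathcal P=\langle X\mid R\rangle_{\mathcal S_2}$ of a metabelian group $G$ consists of finite sets $X$ and $R\subseteq\tilde F(X)$ together with an epimorphism $\tilde F(X)\to G$ whose kernel is the normal closure of $R$ in $\tilde F(X)$. Every finitely generated metabelian group has such a presentation. For a word $w$ over $X^{\pm1}$ representing $1$ in $G$, the relative area is the smallest $N$ such that $w=_{\tilde F(X)}\prod_{i=1}^N g_i^{-1}r_ig_i$ with $r_i\in R\cup R^{-1}$, $g_i\in\tilde F(X)$. The relative Dehn function $\tilde\delta_{\mathcal P}(n)$ is the supremum of the relative areas of words $w=_G1$ with $|w|_X\le n$. Up to $\approx$ (below) it does not depend on $\mathcal P$, and it is denoted $\tilde\delta_G$. Comparison of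 functions on $\mathbb N$: $f\preccurlyeq g$ (equivalently $g\succcurlyeq f$) means there is $C>0$ with $f(n)\le Cg(Cn)+Cn+C$ for all $n\in\mathbb N$; $f\approx g$ means $f\preccurlyeq g$ and $g\preccurlyeq f$. *)

(* Defs.v *)
From HB Require Import structures.
From mathcomp Require Import all_boot all_algebra finmap boolp classical_sets.

Set Implicit Arguments.
Unset Strict Implicit.
Unset Printing Implicit Defensive.

Local Open Scope fset_scope.
Local Open Scope quotient_scope.
Local Open Scope classical_set_scope.
Local Open Scope group_scope.

Record is_subgroup (G : groupType) (H : set G) : Prop := IsSubgroup {
  subgroup1 : H 1;
  subgroupM : forall x y, H x -> H y -> H (x * y);
  subgroupV : forall x, H x -> H x^-1 }.

Record is_normal (G : groupType) (N : set G) : Prop := IsNormal {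
  normal_subgroup :> is_subgroup N;
  normalJ : forall x g, N x -> N (x ^ g) }.

Record normalSubgroup (G : groupType) := NormalSubgroup {
  normal_set :> G -> Prop;
  normalP : is_normal normal_set }.

Definition generated (G : groupType) (S : set G) : set G :=
  [set x | forall H : set G, is_subgroup H -> S `<=` H -> H x].

Definition normal_closure (G : groupType) (S : set G) : set G :=
  [set x | forall N : set G, is_normal N -> S `<=` N -> N x].

Lemma normal_closure_is_normal (G : groupType) (S : set G) :
  is_normal (normal_closure S).
Proof.
split; first split.
- by move=> N nN _; apply: (subgroup1 nN).
- move=> x y hx hy N nN sN.
  by apply: (subgroupM nN); [apply: hx | apply: hy].
- by move=> x hx N nN sN; apply: (subgroupV nN); apply: hx.
- by move=> x g hx N nN sN; apply: (normalJ nN); apply: hx.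
Qed.

Definition nclosure (G : groupType) (S : set G) : normalSubgroup G :=
  NormalSubgroup (normal_closure_is_normal S).

Definition derived (G : groupType) (H : set G) : set G :=
  generated [set z | exists x y, [/\ H x, H y & z = [~ x, y]]].

Lemma derived_is_normal (G : groupType) (H : set G) :
  is_normal H -> is_normal (derived H).
Proof.
move=> nH; split; first split.
- by move=> K sK _; apply: (subgroup1 sK).
- move=> x y hx hy K sK sHK.
  by apply: (subgroupM sK); [apply: hx | apply: hy].
- by move=> x hx K sK sHK; apply: (subgroupV sK); apply: hx.
- move=> x g hx K sK sHK.
  apply: (hx [set z | K (z ^ g)]); first split => /=.
  + by rewrite conj1g; apply: (subgroup1 sK).
  + by move=> u v hu hv; rewrite conjMg; apply: (subgroupM sK).
  + by move=> u hu; rewrite conjVg; apply: (subgroupV sK).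
  + move=> _ [u [v [hu hv ->]]] /=; apply: sHK.
    by exists (u ^ g), (v ^ g); split; [exact: normalJ | exact: normalJ |
      rewrite conjRg].
Qed.

Lemma setT_is_normal (G : groupType) : is_normal [set: G].
Proof. by []. Qed.

Definition second_derived (G : groupType) : normalSubgroup G :=
  NormalSubgroup (derived_is_normal (derived_is_normal (setT_is_normal G))).

Section QuotientGroup.
Variables (G : groupType) (N : normalSubgroup G).

Let nN : is_normal N := normalP N.

Definition coset_rel : rel G := fun x y => `[< N (x^-1 * y) >].

Lemma coset_rel_equiv : equiv_class_of coset_rel.
Proof.
split=> [x|x y|y x z].
- by apply/asboolP; rewrite mulVg; apply: (subgroup1 nN).
- by apply/asboolP/asboolP => /(subgroupV nN); rewrite invgM invgK.
- move=> /asboolP xy /asboolP yz; apply/asboolP.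
  by have := subgroupM nN xy yz; rewrite -mulgA mulVKg.
Qed.

Canonical coset_equiv : equiv_rel G := EquivRelPack coset_rel_equiv.

Definition quotient_group : Type := {eq_quot coset_equiv}.

HB.instance Definition _ := EqQuotient.on quotient_group.
HB.instance Definition _ := Choice.on quotient_group.

Definition coset (x : G) : quotient_group := \pi_quotient_group x.

Definition quotient_mul (u v : quotient_group) := coset (repr u * repr v).
Definition quotient_inv (u : quotient_group) := coset (repr u)^-1.

Lemma coset_eqP x y : coset x = coset y <-> N (x^-1 * y).
Proof.
rewrite /coset; split => [/eqP|h]; first by rewrite eqmodE => /asboolP.
by apply/eqP; rewrite eqmodE; apply/asboolP.
Qed.

Lemma repr_cosetK u : coset (repr u) = u. Proof. exact: reprK. Qed.

Lemma quotient_mulE x y : quotient_mul (coset x) (coset y) = coset (x * y).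
Proof.
apply/coset_eqP; rewrite invgM.
have /coset_eqP hx := repr_cosetK (coset x).
have /coset_eqP hy := repr_cosetK (coset y).
have := subgroupM nN (normalJ nN (repr (coset y)) hx) hy.
by rewrite /conjg !mulgA mulgK.
Qed.

Lemma quotient_invE x : quotient_inv (coset x) = coset x^-1.
Proof.
apply/coset_eqP; rewrite invgK.
have /coset_eqP hx := esym (repr_cosetK (coset x)).
have := normalJ nN x^-1 hx.
by rewrite /conjg invgK !mulgA mulgV mul1g.
Qed.

Lemma quotient_mulA : associative quotient_mul.
Proof.
move=> u v w; rewrite -(repr_cosetK u) -(repr_cosetK v) -(repr_cosetK w).
by rewrite !quotient_mulE mulgA.
Qed.

Lemma quotient_mul1g : left_id (coset 1) quotient_mul.
Proof. by move=> u; rewrite -(repr_cosetK u) quotient_mulE mul1g. Qed.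

Lemma quotient_mulg1 : right_id (coset 1) quotient_mul.
Proof. by move=> u; rewrite -(repr_cosetK u) quotient_mulE mulg1. Qed.

Lemma quotient_mulVg : left_inverse (coset 1) quotient_inv quotient_mul.
Proof.
by move=> u; rewrite -(repr_cosetK u) quotient_invE quotient_mulE mulVg.
Qed.

Lemma quotient_mulgV : right_inverse (coset 1) quotient_inv quotient_mul.
Proof.
by move=> u; rewrite -(repr_cosetK u) quotient_invE quotient_mulE mulgV.
Qed.

HB.instance Definition _ := isGroup.Build quotient_group
  quotient_mulA quotient_mul1g quotient_mulg1 quotient_mulVg quotient_mulgV.

Lemma cosetM : {morph coset : x y / x * y}.
Proof. by move=> x y; exact/esym/quotient_mulE. Qed.

HB.instance Definition _ :=
  isUMagmaMorphism.Build G quotient_group coset (erefl, cosetM).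

End QuotientGroup.

(** The letter [(x, false)] stands for [x] and [(x, true)] for [x^-1]. *)
Definition word (X : Type) := seq (X * bool).

Definition inv_letter (X : Type) (e : X * bool) : X * bool := (e.1, ~~ e.2).

Lemma inv_letterK (X : Type) : involutive (@inv_letter X).
Proof. by case=> x b; rewrite /inv_letter /= negbK. Qed.

Definition inv_word (X : Type) (w : word X) : word X :=
  rev (map (@inv_letter X) w).

Inductive freely_equal (X : Type) : word X -> word X -> Prop :=
| freely_refl w : freely_equal w w
| freely_sym u v : freely_equal u v -> freely_equal v u
| freely_trans v u w :
    freely_equal u v -> freely_equal v w -> freely_equal u w
| freely_cancel u v e : freely_equal (u ++ e :: inv_letter e :: v) (u ++ v).

Section FreeGroup.
Variable X : choiceType.

Definition free_rel : rel (word X) := fun u v => `[< freely_equal u v >].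

Lemma free_rel_equiv : equiv_class_of free_rel.
Proof.
split=> [w|u v|v u w].
- by apply/asboolP; exact: freely_refl.
- by apply/asboolP/asboolP; exact: freely_sym.
- by move=> /asboolP uv /asboolP vw; apply/asboolP/(freely_trans uv vw).
Qed.

Canonical free_equiv : equiv_rel (word X) := EquivRelPack free_rel_equiv.

Definition free_group : Type := {eq_quot free_equiv}.

HB.instance Definition _ := EqQuotient.on free_group.
HB.instance Definition _ := Choice.on free_group.

Definition free_class (w : word X) : free_group := \pi_free_group w.

Definition free_mul (u v : free_group) := free_class (repr u ++ repr v).
Definition free_inv (u : free_group) := free_class (inv_word (repr u)).

Lemma free_classP u v : free_class u = free_class v <-> freely_equal u v.
Proof.
rewrite /free_class; split => [/eqP|h]; first by rewrite eqmodE => /asboolP.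
by apply/eqP; rewrite eqmodE; apply/asboolP.
Qed.

Lemma repr_freeK u : free_class (repr u) = u. Proof. exact: reprK. Qed.

Lemma freely_equal_ctx (p q u v : word X) :
  freely_equal u v -> freely_equal (p ++ u ++ q) (p ++ v ++ q).
Proof.
elim=> [w|{}u {}v _|{}v {}u w _ uv _|{}u {}v e].
- exact: freely_refl.
- exact: freely_sym.
- exact: freely_trans.
- by rewrite -!catA !cat_cons !(catA p u); exact: freely_cancel.
Qed.

Lemma freely_equal_inv (u v : word X) :
  freely_equal u v -> freely_equal (inv_word u) (inv_word v).
Proof.
elim=> [w|{}u {}v _|{}v {}u w _ uv _|{}u {}v e].
- exact: freely_refl.
- exact: freely_sym.
- exact: freely_trans.
- rewrite /inv_word !map_cat !rev_cat /= !rev_cons -!cats1 -!catA /=.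
  by have := freely_cancel (rev (map (@inv_letter X) v))
    (rev (map (@inv_letter X) u)) (inv_letter (inv_letter e));
    rewrite !inv_letterK.
Qed.

Lemma freely_equal_invl (w : word X) : freely_equal (inv_word w ++ w) [::].
Proof.
elim: w => [|e w IHw]; first exact: freely_refl.
rewrite /inv_word /= rev_cons -cats1 -catA /=.
apply: freely_trans IHw.
have := freely_cancel (inv_word w) w (inv_letter e).
by rewrite inv_letterK.
Qed.

Lemma inv_wordK : involutive (@inv_word X).
Proof.
move=> w; rewrite /inv_word map_rev revK -map_comp map_id_in // => e _.
exact: inv_letterK.
Qed.

Lemma free_mulE u v :
  free_mul (free_class u) (free_class v) = free_class (u ++ v).
Proof.
have /free_classP hu := repr_freeK (free_class u).
have /free_classP hv := repr_freeK (free_class v).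
apply/free_classP; apply: (freely_trans (v := u ++ repr (free_class v))).
  exact: (freely_equal_ctx [::] _ hu).
by have := freely_equal_ctx u [::] hv; rewrite !cats0.
Qed.

Lemma free_invE u : free_inv (free_class u) = free_class (inv_word u).
Proof.
apply/free_classP/freely_equal_inv/free_classP; exact: repr_freeK.
Qed.

Lemma free_mulA : associative free_mul.
Proof.
move=> u v w; rewrite -(repr_freeK u) -(repr_freeK v) -(repr_freeK w).
by rewrite !free_mulE catA.
Qed.

Lemma free_mul1g : left_id (free_class [::]) free_mul.
Proof. by move=> u; rewrite -(repr_freeK u) free_mulE. Qed.

Lemma free_mulg1 : right_id (free_class [::]) free_mul.
Proof. by move=> u; rewrite -(repr_freeK u) free_mulE cats0. Qed.

Lemma free_mulVg : left_inverse (free_class [::]) free_inv free_mul.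
Proof.
move=> u; rewrite -(repr_freeK u) free_invE free_mulE.
by apply/free_classP; exact: freely_equal_invl.
Qed.

Lemma free_mulgV : right_inverse (free_class [::]) free_inv free_mul.
Proof.
move=> u; rewrite -(repr_freeK u) free_invE free_mulE; apply/free_classP.
by rewrite -{1}(inv_wordK (repr u)); exact: freely_equal_invl.
Qed.

HB.instance Definition _ := isGroup.Build free_group
  free_mulA free_mul1g free_mulg1 free_mulVg free_mulgV.

Definition free_metabelian : groupType :=
  quotient_group (second_derived free_group).

Definition word_class (w : word X) : free_metabelian :=
  coset (second_derived free_group) (free_class w).

End FreeGroup.

Record rel_presentation (G : groupType) := RelPresentation {
  gens : finType;
  rels : {fset free_metabelian gens};
  proj : {multiplicative free_metabelian gens -> G};
  proj_surj : forall g, exists x, proj x = g;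
  proj_ker : forall x, proj x = 1 <-> normal_closure [set` rels] x }.

Section RelativeDehn.
Variables (G : groupType) (P : rel_presentation G).

(** [s] lists the pairs [(r_i, g_i)]; recall [r ^ g = g^-1 * (r * g)]. *)
Definition conj_product (N : nat) (w : word (gens P)) : Prop :=
  exists s : seq (free_metabelian (gens P) * free_metabelian (gens P)),
    [/\ size s = N,
        forall p, p \in s -> (p.1 \in rels P) || (p.1^-1 \in rels P) &
        word_class w = \prod_(p <- s) p.1 ^ p.2].

(** Junk value [0] on words that do not represent [1] in [G]. *)
Definition rel_area (w : word (gens P)) : nat :=
  if pselect (exists N, `[< conj_product N w >]) is left ex
  then ex_minn ex else 0%N.

Definition rel_dehn (n : nat) : nat :=
  (\max_(w : n.-bseq (gens P * bool) | proj P (word_class w) == 1%g)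
    rel_area w)%N.

End RelativeDehn.

(** As [g] is only defined on natural numbers, [C] is an integer. *)
Definition dominated (f g : nat -> nat) : Prop :=
  exists2 C : nat, (0 < C)%N & forall n, (f n <= C * g (C * n) + C * n + C)%N.

(** [Wreath f s] is the product [f * s] of [f] in the base group and [s] in
    [T].  The base element with value [c] at [x] and [1] elsewhere is [c] in
    the copy [A^x]; translation is on the right: [t^-1 * A^x * t = A^(x * t)]. *)
Record wreath (A T : groupType) := Wreath {
  wreath_base : {fsfun T -> A with (1 : A)};
  wreath_top : T }.

Section WreathProduct.
Variables A T : groupType.
Local Notation base := {fsfun T -> A with (1 : A)}.
Local Notation W := (wreath A T).

Definition pair_of_wreath (u : W) : base * T :=
  (wreath_base u, wreath_top u).
Definition wreath_of_pair (p : base * T) : W := Wreath p.1 p.2.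

Lemma pair_of_wreathK : cancel pair_of_wreath wreath_of_pair.
Proof. by case. Qed.

HB.instance Definition _ := Choice.copy W (can_type pair_of_wreathK).

Definition wreath_one : W := Wreath [fsfun] 1.

Definition wreath_mul (u v : W) : W :=
  let: Wreath f s := u in let: Wreath g t := v in
  Wreath
    [fsfun x in (finsupp f `|` [fset (y * s^-1)%g | y in finsupp g])%fset
       => f x * g (x * s)]
    (s * t).

Definition wreath_inv (u : W) : W :=
  let: Wreath f s := u in
  Wreath [fsfun x in [fset y * s | y in finsupp f] => (f (x * s^-1))^-1] s^-1.

Lemma wreath_eq (u v : W) :
  wreath_base u =1 wreath_base v -> wreath_top u = wreath_top v -> u = v.
Proof. by case: u v => [f s] [g t] /= /fsfunP -> ->. Qed.

Lemma wreath_mulE u v x : wreath_base (wreath_mul u v) x =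
  wreath_base u x * wreath_base v (x * wreath_top u).
Proof.
case: u v => [f s] [g t] /=; rewrite fsfunE; case: ifP => // /negbT.
rewrite inE negb_or => /andP[/fsfun_dflt -> nx]; rewrite mul1g fsfun_dflt //.
by apply: contra nx => gx; apply/imfsetP; exists (x * s); rewrite ?mulgK.
Qed.

Lemma wreath_invE u x : wreath_base (wreath_inv u) x =
  (wreath_base u (x * (wreath_top u)^-1))^-1.
Proof.
case: u => [f s] /=; rewrite fsfunE; case: ifP => // /negbT nx.
rewrite fsfun_dflt ?invg1 //.
by apply: contra nx => fx; apply/imfsetP; exists (x * s^-1); rewrite ?mulgVK.
Qed.

Lemma wreath_topM u v :
  wreath_top (wreath_mul u v) = wreath_top u * wreath_top v.
Proof. by case: u v => [f s] []. Qed.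

Lemma wreath_topV u : wreath_top (wreath_inv u) = (wreath_top u)^-1.
Proof. by case: u. Qed.

Lemma wreath_mulA : associative wreath_mul.
Proof.
move=> u v w; apply: wreath_eq => [x|]; last by rewrite !wreath_topM mulgA.
by rewrite !wreath_mulE wreath_topM !mulgA.
Qed.

Lemma wreath_mul1g : left_id wreath_one wreath_mul.
Proof.
move=> u; apply: wreath_eq => [x|]; last by rewrite wreath_topM mul1g.
by rewrite wreath_mulE /= fsfunE mul1g mulg1.
Qed.

Lemma wreath_mulg1 : right_id wreath_one wreath_mul.
Proof.
move=> u; apply: wreath_eq => [x|]; last by rewrite wreath_topM mulg1.
by rewrite wreath_mulE /= fsfunE mulg1.
Qed.

Lemma wreath_mulVg : left_inverse wreath_one wreath_inv wreath_mul.
Proof.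
move=> u; apply: wreath_eq => [x|]; last by rewrite wreath_topM wreath_topV mulVg.
by rewrite wreath_mulE wreath_invE wreath_topV mulVg /= fsfunE.
Qed.

Lemma wreath_mulgV : right_inverse wreath_one wreath_inv wreath_mul.
Proof.
move=> u; apply: wreath_eq => [x|]; last by rewrite wreath_topM wreath_topV mulgV.
by rewrite wreath_mulE wreath_invE mulgK mulgV /= fsfunE.
Qed.

HB.instance Definition _ := isGroup.Build W
  wreath_mulA wreath_mul1g wreath_mulg1 wreath_mulVg wreath_mulgV.

Definition wreath_inl (c : A) : W := Wreath [fsfun x in [fset 1] => c] 1.
Definition wreath_inr (t : T) : W := Wreath [fsfun] t.

End WreathProduct.

Definition infinite_cyclic : groupType := Algebra.to_multiplicative int.
Definition cyclic_gen : infinite_cyclic := (1%R : int).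

Definition W : groupType := wreath infinite_cyclic infinite_cyclic.
Definition W_a : W := wreath_inl infinite_cyclic cyclic_gen.
Definition W_t : W := wreath_inr infinite_cyclic cyclic_gen.

(** [w_ 1 = a] and [w_ l = [~ w_ l.-1, t]] for [l >= 2]; [w_ 0] is unused. *)
Definition w_ (l : nat) : W := iter l.-1 (fun x => [~ x, W_t]) W_a.

Definition H_ (l : nat) : groupType := quotient_group (nclosure [set w_ l]).

(* Main.v *)
Require Import Defs.
From mathcomp Require Import all_boot.
From mathcomp Require Import all_algebra finmap boolp classical_sets.
From mathcomp Require Import zify ring.

Set Implicit Arguments.
Unset Strict Implicit.
Unset Printing Implicit Defensive.

(** The group [H_ m.+2] is a central extension of [H_ m.+1] by the infinite
cyclic group generated by the image of [w_ m.+1].  Lifting the generators of a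
presentation of [H_ m.+1] to it maps the relators into the central subgroup, so
that a product of [N] conjugates of relators is a power of [w_ m.+1] with
exponent at most [M * N], where [M] depends only on the presentation.  But
[[a^n, t^n, ..., t^n]], with [m] factors [t^n], has length linear in [n] and
equals the power of [w_ m.+1] with exponent [n^(m+1)], for in the base group
it is [n (t^n - 1)^m = n^(m+1) (t - 1)^m] modulo [(t - 1)^(m+1)].

This is computed in [W] itself, with the moments [sum_x u(x) p(x)] of the base
elements [u] against integer polynomials [p]: the normal closure of [w_ m.+1]
is orthogonal to the polynomials of degree less than [m], so that the moment
against ['X^m] is an additive function on it, invariant under conjugation. *)

Local Open Scope fset_scope.
Local Open Scope classical_set_scope.
Local Open Scope group_scope.

(** * Evaluation of words in a group, and maps out of free metabelian groups *)

Definition word_eval (X : Type) (E : groupType) (u : X -> E) (w : word X) : E :=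
  \prod_(e <- w) (if e.2 then (u e.1)^-1 else u e.1).

Lemma word_eval_cat (X : Type) (E : groupType) (u : X -> E) (v w : word X) :
  word_eval u (v ++ w) = word_eval u v * word_eval u w.
Proof. exact: big_cat. Qed.

Lemma morphg1 (G E : groupType) (f : G -> E) :
  {morph f : x y / x * y} -> f 1 = 1.
Proof. by move=> fM; apply: (mulgI (f 1)); rewrite -fM !mulg1. Qed.

Lemma morphgV (G E : groupType) (f : G -> E) :
  {morph f : x y / x * y} -> {morph f : x / x^-1}.
Proof.
by move=> fM x; apply: (mulgI (f x)); rewrite -fM !mulgV (morphg1 fM).
Qed.

Lemma morph_word_eval (X : Type) (G E : groupType) (f : G -> E) (u : X -> G)
    (w : word X) : {morph f : x y / x * y} ->
  f (word_eval u w) = word_eval (f \o u) w.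
Proof.
move=> fM; rewrite /word_eval (big_morph f fM (morphg1 fM)).
by apply: eq_bigr => -[x [|]] _ //=; rewrite (morphgV fM).
Qed.

Lemma freely_equal_word_eval (X : Type) (E : groupType) (u : X -> E)
    (v w : word X) :
  freely_equal v w -> word_eval u v = word_eval u w.
Proof.
elim=> [//|{}v {}w _ -> //|x {}v {}w _ -> _ -> //|{}v {}w [x b]].
rewrite !word_eval_cat /word_eval !big_cons /=.
by case: b => /=; rewrite ?mulKg ?mulVKg.
Qed.

Definition free_eval (X : choiceType) (E : groupType) (u : X -> E)
    (x : free_group X) : E := word_eval u (repr x).

Lemma free_evalE (X : choiceType) (E : groupType) (u : X -> E) (w : word X) :
  free_eval u (free_class w) = word_eval u w.
Proof.
by apply: freely_equal_word_eval; apply/free_classP; exact: repr_freeK.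
Qed.

Lemma free_evalM (X : choiceType) (E : groupType) (u : X -> E) :
  {morph free_eval u : x y / x * y}.
Proof.
move=> x y; rewrite -(repr_freeK x) -(repr_freeK y).
by rewrite [_ * _]free_mulE !free_evalE word_eval_cat.
Qed.

Lemma morph_derived (G E : groupType) (f : G -> E) (H : set G) (H' : set E) :
    {morph f : x y / x * y} -> (forall x, H x -> H' (f x)) ->
  forall x, derived H x -> derived H' (f x).
Proof.
move=> fM fH x Hx.
have [f1 fV] := (morphg1 fM, morphgV fM).
apply: (Hx [set y | derived H' (f y)]); first split => /=.
- by rewrite f1 => K [].
- by move=> y z hy hz; rewrite fM => K sK sHK; apply: (subgroupM sK);
    [apply: hy | apply: hz].
- by move=> y hy; rewrite fV => K sK sHK; apply: (subgroupV sK); apply: hy.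
- move=> _ [y [z [Hy Hz ->]]] K sK; apply.
  exists (f y), (f z); split; [exact: fH | exact: fH |].
  by rewrite /commg /conjg !fM !fV.
Qed.

Definition metabelian (E : groupType) : Prop :=
  forall x, second_derived E x -> x = 1.

(** Evaluation at a chosen representative; the choice is immaterial, and the map is a morphism, once
    [E] is metabelian. *)
Definition metabelian_eval (X : choiceType) (E : groupType) (u : X -> E)
    (z : free_metabelian X) : E := free_eval u (repr z).

Lemma metabelian_evalE (X : choiceType) (E : groupType) (u : X -> E)
    (w : word X) : metabelian E ->
  metabelian_eval u (word_class w) = word_eval u w.
Proof.
move=> abE; rewrite -free_evalE /metabelian_eval.
set x := free_class w; set y := repr _.
have /coset_eqP Nyx : coset (second_derived (free_group X)) y = coset _ x.
  exact: repr_cosetK.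
(* Two representatives differ by an element of the second derived subgroup, whose image in [E] is
   trivial. *)
have /abE : second_derived E (free_eval u (y^-1 * x)).
  apply: (morph_derived (@free_evalM _ _ u)) Nyx.
  by apply: morph_derived => //; exact: free_evalM.
have fV := morphgV (@free_evalM _ _ u).
by rewrite free_evalM fV => /(congr1 (fun v => free_eval u y * v));
  rewrite mulVKg mulg1.
Qed.

Lemma word_class_surj (X : choiceType) (z : free_metabelian X) :
  exists w : word X, z = word_class w.
Proof.
by exists (repr (repr z)); rewrite /word_class repr_freeK repr_cosetK.
Qed.

Lemma word_class_cat (X : choiceType) (v w : word X) :
  word_class (v ++ w) = word_class v * word_class w.
Proof. by rewrite /word_class -free_mulE cosetM. Qed.

Lemma metabelian_evalM (X : choiceType) (E : groupType) (u : X -> E) :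
  metabelian E -> {morph metabelian_eval u : x y / x * y}.
Proof.
move=> abE x y; have [[v ->] [w ->]] := (word_class_surj x, word_class_surj y).
by rewrite -word_class_cat !metabelian_evalE // word_eval_cat.
Qed.

Lemma word_class_inv (X : choiceType) (w : word X) :
  word_class (inv_word w) = (word_class w)^-1.
Proof.
rewrite /word_class -free_invE.
by rewrite (morphgV (@cosetM _ (second_derived _))).
Qed.

(** Lets a morphism out of the free metabelian group be computed from its values on the
    generators. *)
Lemma word_class_eval (X : choiceType) (w : word X) :
  word_class w = word_eval (fun x => word_class [:: (x, false)]) w.
Proof.
elim: w => [//|[x b] w IHw]; first by rewrite /word_eval big_nil.
rewrite -cat1s word_class_cat word_eval_cat IHw; congr (_ * _).
rewrite /word_eval big_seq1; case: b => //=.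
by rewrite -word_class_inv.
Qed.

(** * Lower bounds for the relative area *)

Definition conj_products (G : groupType) (R : {pred G}) : set G :=
  [set x | exists2 s : seq (G * G),
    forall p, p \in s -> (p.1 \in R) || (p.1^-1 \in R) &
    x = \prod_(p <- s) p.1 ^ p.2].

Lemma conj_products_normal (G : groupType) (R : {pred G}) :
  is_normal (conj_products R).
Proof.
split; first split.
- by exists [::]; rewrite ?big_nil.
- move=> _ _ [s sR ->] [s' s'R ->]; exists (s ++ s'); last by rewrite big_cat.
  by move=> p; rewrite mem_cat => /orP[/sR|/s'R].
- move=> _ [s sR ->]; exists (rev [seq (p.1^-1, p.2) | p <- s]).
    move=> p; rewrite mem_rev => /mapP[q /sR qR ->] /=.
    by rewrite invgK orbC.
  elim: s {sR} => [|p s IHs]; first by rewrite !big_nil invg1.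
  rewrite big_cons invgM IHs /= rev_cons -cats1 big_cat big_seq1 /=.
  by rewrite conjVg.
- move=> _ g [s sR ->]; exists [seq (p.1, p.2 * g) | p <- s].
    by move=> p /mapP[q /sR qR ->].
  by rewrite conjg_prod big_map; apply: eq_bigr => p _; rewrite /= conjgM.
Qed.

(** The products of conjugates of relators form a normal subgroup containing the relators, hence
    containing the kernel of [proj P]. This keeps [rel_area] off its junk value. *)
Lemma conj_product_exists (G : groupType) (P : rel_presentation G)
    (w : word (gens P)) :
  proj P (word_class w) = 1 -> exists N, conj_product N w.
Proof.
move=> /proj_ker /(_ _ (conj_products_normal (mem (rels P)))).
case=> [r rP|s sP ws]; last by exists (size s), s.
exists [:: (r, 1)] => [p|]; last by rewrite big_seq1 conjg1.
by rewrite inE => /eqP -> /=; rewrite [_ \in _]rP.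
Qed.

(** Each factor, a conjugate of a relator or of its inverse, adds at most [M] to the absolute value
    of [f]. *)
Lemma rel_area_ge (G : groupType) (P : rel_presentation G)
    (f : free_metabelian (gens P) -> int) (M : nat) (w : word (gens P)) :
    (forall x y, proj P x = 1 -> proj P y = 1 -> f (x * y) = (f x + f y)%R) ->
    (forall x g, proj P x = 1 -> f (x ^ g) = f x) ->
    (forall r, r \in rels P -> `|f r| <= M)%N ->
  proj P (word_class w) = 1 -> (`|f (word_class w)| <= M * rel_area w)%N.
Proof.
move=> fM fJ fR w1; rewrite /rel_area.
case: pselect => [ex|]; last first.
  by case: (conj_product_exists w1) => N cN []; exists N; apply/asboolP.
case: ex_minnP => _ /asboolP[s [<- sR ->]] _.
have pM : {morph proj P : x y / x * y} by exact: gmulfM.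
have [p1 pV] := (morphg1 pM, morphgV pM).
have f1 : f 1 = 0%R.
  by apply: (GRing.addrI (f 1)); rewrite -fM // mulg1 GRing.addr0.
have fV x : proj P x = 1 -> f x^-1 = (- f x)%R.
  move=> x1; apply: (GRing.addrI (f x)); rewrite -fM // ?pV ?x1 ?invg1 //.
  by rewrite mulgV GRing.subrr.
have R1 r : r \in rels P -> proj P r = 1.
  by move=> rR; apply/proj_ker => N _; apply.
(* [f] is assumed additive only on the kernel of [proj P], so the induction also carries membership
   of the product in that kernel. *)
suff [] : proj P (\prod_(p <- s) p.1 ^ p.2) = 1 /\
  (`|f (\prod_(p <- s) p.1 ^ p.2)%g| <= M * size s)%N by [].
elim: s sR => [|[r g] s IHs] sR; first by rewrite big_nil p1 f1.
have [q qR|s1 sM] := IHs; first by apply: sR; rewrite inE qR orbT.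
have [r1 rM] : proj P r = 1 /\ (`|f r| <= M)%N.
  have /orP[rR|rR] /= := sR (r, g) (mem_head _ _).
    by split; [exact: R1 | exact: fR].
  have r1 : proj P r = 1 by rewrite -[r]invgK pV R1 // invg1.
  by split=> //; move: (fR _ rR); rewrite fV // abszN.
have rg1 : proj P (r ^ g) = 1 by rewrite /conjg !pM pV r1 mul1g mulVg.
rewrite big_cons /= pM rg1 s1 mulg1 fM // fJ //; split=> //.
rewrite mulnS; apply: leq_trans (leq_add rM sM).
have absD (a b : int) : (`|(a + b)%R| <= `|a| + `|b|)%N by lia.
exact: absD.
Qed.

Lemma rel_area_le_dehn (G : groupType) (P : rel_presentation G) (n : nat)
    (w : word (gens P)) : (size w <= n)%N -> proj P (word_class w) = 1 ->
  (rel_area w <= rel_dehn P n)%N.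
Proof.
move=> wn w1; rewrite /rel_dehn.
have := @leq_bigmax_cond _ (fun v : n.-bseq _ => proj P (word_class v) == 1)
  (fun v => rel_area v) (Bseq wn).
by apply; rewrite /= w1.
Qed.

(** * Finite differences of integer polynomials *)

Definition poly_shift (s : int) (p : {poly int}) : {poly int} :=
  (p \Po ('X + s%:P))%R.

Definition poly_diff (s : int) (p : {poly int}) : {poly int} :=
  (poly_shift s p - p)%R.

Lemma horner_shift (s : int) (p : {poly int}) (x : int) :
  ((poly_shift s p).[x] = p.[x + s])%R.
Proof. by rewrite horner_comp !hornerE. Qed.

Lemma poly_diff_small (s : int) (p : {poly int}) :
  (size p <= 1)%N -> poly_diff s p = 0%R.
Proof.
move=> /size1_polyC ->.
by rewrite /poly_diff /poly_shift comp_polyC GRing.subrr.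
Qed.

(** A product rule for the difference operator, made for induction along Horner's scheme. *)
Lemma poly_diffMXaddC (s c : int) (p : {poly int}) :
  (poly_diff s (p * 'X + c%:P)
     = poly_diff s p * 'X + s *: poly_diff s p + s *: p)%R.
Proof.
rewrite /poly_diff /poly_shift comp_poly_MXaddC -!mul_polyC; ring.
Qed.

Lemma size_poly_diff (s : int) (p : {poly int}) (k : nat) :
  (size p <= k.+1)%N -> (size (poly_diff s p) <= k)%N.
Proof.
elim/poly_ind: p k => [|p c IHp] k; first by rewrite poly_diff_small size_poly0.
rewrite size_MXaddC poly_diffMXaddC; case: ifP => [/andP[/eqP -> _] _|_].
  by rewrite poly_diff_small ?size_poly0 // GRing.mul0r !GRing.scaler0
    !GRing.addr0 size_poly0.
rewrite ltnS; case: k => [|k pk].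
  by rewrite leqn0 size_poly_eq0 => /eqP ->; rewrite poly_diff_small
    ?size_poly0 // GRing.mul0r !GRing.scaler0 !GRing.addr0 size_poly0.
have dk := IHp _ pk.
apply/leq_sizeP => -[//|j] kj; rewrite !coefD !coefZ coefMX /=.
rewrite !nth_default ?GRing.mulr0 ?GRing.addr0 //.
- by apply: leq_trans pk _.
- by apply: leq_trans dk _; apply: leq_trans kj.
- by apply: leq_trans dk _.
Qed.

Lemma coef_poly_diff (s : int) (p : {poly int}) (k : nat) :
  (size p <= k.+2)%N -> ((poly_diff s p)`_k = s * p`_k.+1 *+ k.+1)%R.
Proof.
elim/poly_ind: p k => [|p c IHp] k sp.
  by rewrite poly_diff_small ?size_poly0 // !coef0 GRing.mulr0 GRing.mul0rn.
have {}sp : (size p <= k.+1)%N.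
  move: sp; rewrite size_MXaddC; case: ifP => [/andP[/eqP -> _]|//].
  by rewrite size_poly0.
rewrite poly_diffMXaddC !coefD !coefZ !coefMX coefC /= GRing.addr0.
(* [poly_diff s p] has size at most [k], so its coefficient of index [k] vanishes. *)
rewrite [X in (_ + s * X + _)%R]nth_default ?size_poly_diff //.
rewrite GRing.mulr0 GRing.addr0.
case: k sp => [|k] sp; first by rewrite GRing.add0r.
by rewrite /= IHp // [RHS]GRing.mulrSr.
Qed.

(** Each difference lowers the degree bound by one and multiplies the top coefficient by [s] times
    its index. *)
Lemma iter_poly_diff (s : int) (m : nat) (p : {poly int}) :
  (size p <= m.+1)%N ->
  (iter m (poly_diff s) p = (s ^+ m * p`_m *+ m`!)%:P)%R.
Proof.
elim: m p => [|m IHm] p sp.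
  by rewrite GRing.expr0 GRing.mul1r; exact: size1_polyC.
rewrite iterSr IHm ?size_poly_diff // coef_poly_diff //; congr (_%:P)%R.
by rewrite GRing.mulrnAr GRing.mulrA -GRing.exprSr -GRing.mulrnA.
Qed.

(** * Moments of base elements against polynomials *)

Definition moment (p : {poly int}) (u : W) : int :=
  (\sum_(x <- finsupp (wreath_base u)) (wreath_base u x : int) * p.[x : int])%R.

(** Gives the moments of several elements a common range of summation. *)
Lemma moment_sub (p : {poly int}) (u : W) (S : {fset infinite_cyclic}) :
  (finsupp (wreath_base u) `<=` S)%fset ->
  moment p u = (\sum_(x <- S) (wreath_base u x : int) * p.[x : int])%R.
Proof.
move=> uS; apply: big_fset_incl => // x _ xu.
by rewrite fsfun_dflt // GRing.mul0r.
Qed.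

Lemma momentM (p : {poly int}) (u v : W) : wreath_top u = 1 ->
  moment p (u * v) = (moment p u + moment p v)%R.
Proof.
move=> u1.
set S := (finsupp (wreath_base u) `|` finsupp (wreath_base v)
  `|` finsupp (wreath_base (u * v)))%fset.
have [uS vS wS] : [/\ finsupp (wreath_base u) `<=` S,
    finsupp (wreath_base v) `<=` S & finsupp (wreath_base (u * v)) `<=` S]%fset.
  by split; apply/fsubsetP => x xS; rewrite !in_fsetU xS ?orbT.
rewrite (moment_sub p uS) (moment_sub p vS) (moment_sub p wS).
rewrite -big_split; apply: eq_bigr => x _.
rewrite wreath_mulE u1 mulg1; exact: GRing.mulrDl.
Qed.

Lemma wreath_baseJ (u g : W) (x : infinite_cyclic) : wreath_top u = 1 ->
  wreath_base (u ^ g) x = wreath_base u (x / wreath_top g).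
Proof.
move=> u1; rewrite /conjg.
rewrite !wreath_mulE wreath_invE u1 wreath_topV mulg1 -/(_ / _).
(* The copies of the first factor are abelian, so the base part of [g] cancels. *)
by rewrite [_ * wreath_base g _]Algebra.commuteT mulKg.
Qed.

(** Conjugation by [g] translates the support by [wreath_top g]; reindexing the sum moves the
    translation to the polynomial. *)
Lemma momentJ (p : {poly int}) (u g : W) : wreath_top u = 1 ->
  moment p (u ^ g) = moment (poly_shift (wreath_top g) p) u.
Proof.
move=> u1; set s := wreath_top g.
have sub : (finsupp (wreath_base (u ^ g)) `<=`
    [fset (x * s)%g | x in finsupp (wreath_base u)])%fset.
  apply/fsubsetP => x; rewrite mem_finsupp wreath_baseJ // => xu.
  by apply/imfsetP; exists (x / s); rewrite ?mulgVK //= mem_finsupp.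
rewrite (moment_sub p sub) big_imfset /=; last by move=> x y _ _; exact: mulIg.
apply: eq_bigr => x _; rewrite wreath_baseJ // mulgK.
by rewrite horner_shift.
Qed.

Lemma momentV (p : {poly int}) (u : W) : wreath_top u = 1 ->
  moment p u^-1 = (- moment p u)%R.
Proof.
move=> u1; apply: (GRing.addrI (moment p u)); rewrite -momentM // mulgV.
by rewrite GRing.subrr /moment /= finsupp0 big_seq_fset0.
Qed.

(** As [[~ u, g]] is [u^-1 * u ^ g], taking commutators with [g] is adjoint to the difference
    operator. *)
Lemma momentR (p : {poly int}) (u g : W) : wreath_top u = 1 ->
  moment p [~ u, g] = moment (poly_diff (wreath_top g) p) u.
Proof.
move=> u1; rewrite commgEl momentM ?wreath_topV ?u1 ?invg1 //.
rewrite momentV // momentJ // GRing.addrC /moment -GRing.sumrB.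
by apply: eq_bigr => x _; rewrite -GRing.mulrBr /poly_diff !hornerE.
Qed.

(** * The abelian base group, and its elements with vanishing low moments *)

Lemma wreath_base_commute (u v : W) :
  wreath_top u = 1 -> wreath_top v = 1 -> commute u v.
Proof.
move=> u1 v1; apply: wreath_eq => [x|]; last by rewrite !wreath_topM u1 v1.
by rewrite !wreath_mulE u1 v1 !mulg1; exact: Algebra.commuteT.
Qed.

Lemma wreath_topJ (u g : W) : wreath_top u = 1 -> wreath_top (u ^ g) = 1.
Proof.
by move=> u1; rewrite !wreath_topM wreath_topV u1 mul1g mulVg.
Qed.

Lemma wreath_topR (u g : W) : wreath_top u = 1 -> wreath_top [~ u, g] = 1.
Proof.
by move=> u1; rewrite wreath_topM wreath_topV u1 invg1 mul1g wreath_topJ.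
Qed.

(** The top group is abelian, so commutators lie in the base, which is abelian too. *)
Lemma wreath_metabelian : metabelian W.
Proof.
have top1 (u : W) : derived [set: W] u -> wreath_top u = 1.
  move=> hu; apply: (hu [set v | wreath_top v = 1]); first split => //=.
  - by move=> x y x1 y1; rewrite wreath_topM x1 y1 mulg1.
  - by move=> x x1; rewrite wreath_topV x1 invg1.
  - move=> _ [x [y [_ _ ->]]] /=; rewrite !wreath_topM !wreath_topV.
    by rewrite [wreath_top x * _]Algebra.commuteT mulKg mulVg.
move=> x hx; apply: (hx [set y | y = 1]); first split => //=.
- by move=> y z -> ->; rewrite mulg1.
- by move=> y ->; rewrite invg1.
- move=> _ [y [z [/top1 y1 /top1 z1 ->]]] /=.
  by apply/eqP/commgP/wreath_base_commute.
Qed.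

(** With the base read as Laurent polynomials in [t], these are the multiples of [(t - 1)^k]. *)
Definition low_moments (k : nat) : set W := [set u | wreath_top u = 1 /\
  forall p : {poly int}, (size p <= k)%N -> moment p u = 0%R].

(** The two sides differ by the moment of [[~ u, g]], that is, of [u] against a difference of [p],
    which has size at most [k]. *)
Lemma momentJ_low (k : nat) (p : {poly int}) (u g : W) :
  (size p <= k.+1)%N -> low_moments k u -> moment p (u ^ g) = moment p u.
Proof.
move=> pk [u1 uk]; have := momentR p g u1.
rewrite commgEl uk ?size_poly_diff // momentM ?wreath_topV ?u1 ?invg1 //.
by rewrite momentV // GRing.addrC => /GRing.subr0_eq.
Qed.

Lemma low_moments_normal (k : nat) : is_normal (low_moments k).
Proof.
split; first split.
- split=> // p _; apply: (GRing.addrI (moment p 1)).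
  by rewrite -momentM // mulg1 GRing.addr0.
- move=> u v [u1 uk] [v1 vk]; split; first by rewrite wreath_topM u1 v1 mulg1.
  by move=> p pk; rewrite momentM // uk // vk // GRing.addr0.
- move=> u [u1 uk]; split; first by rewrite wreath_topV u1 invg1.
  by move=> p pk; rewrite momentV // uk // GRing.oppr0.
- move=> u g uk; split; first by case: uk => u1 _; exact: wreath_topJ.
  by move=> p pk; rewrite (momentJ_low _ _ uk) ?(leqW pk) //; apply uk.2.
Qed.

Lemma wreath_top_iterR (m : nat) (u g : W) : wreath_top u = 1 ->
  wreath_top (iter m (fun x => [~ x, g]) u) = 1.
Proof. by move=> u1; elim: m => //= m IHm; exact: wreath_topR. Qed.

Lemma moment_iterR (m : nat) (p : {poly int}) (u g : W) : wreath_top u = 1 ->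
  moment p (iter m (fun x => [~ x, g]) u)
    = moment (iter m (poly_diff (wreath_top g)) p) u.
Proof.
move=> u1; elim: m p => //= m IHm p.
by rewrite momentR ?wreath_top_iterR // IHm -iterSr.
Qed.

(** Moments of [w_ m.+1] are moments of [W_a] against [m]-th differences, which vanish on
    polynomials of size at most [m]. *)
Lemma normal_closure_low_moments (m : nat) (u : W) :
  normal_closure [set w_ m.+1] u -> low_moments m u.
Proof.
apply; first exact: low_moments_normal.
move=> _ ->; split; first exact: wreath_top_iterR.
move=> p pm; rewrite moment_iterR // iter_poly_diff ?(leqW pm) //.
rewrite nth_default // GRing.mulr0 GRing.mul0rn /moment big1 // => x _.
by rewrite hornerC GRing.mulr0.
Qed.

(** * Iterated commutators starting in the base *)

Lemma commMg_base (u v g : W) : wreath_top u = 1 -> wreath_top v = 1 ->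
  [~ u * v, g] = [~ u, g] * [~ v, g].
Proof.
move=> u1 v1; rewrite commgEl conjMg invgM -mulgA [u^-1 * _]mulgA -commgEl.
rewrite mulgA (wreath_base_commute (u := v^-1)) ?mulgA //.
- by rewrite wreath_topV v1 invg1.
- exact: wreath_topR.
Qed.

Lemma iter_commM_base (k : nat) (u v g : W) :
  wreath_top u = 1 -> wreath_top v = 1 ->
  iter k (fun x => [~ x, g]) (u * v)
    = iter k (fun x => [~ x, g]) u * iter k (fun x => [~ x, g]) v.
Proof.
move=> u1 v1; elim: k => //= k ->.
by rewrite commMg_base // wreath_top_iterR.
Qed.

Lemma iter_commJ (G : groupType) (k : nat) (u g : G) :
  iter k (fun x => [~ x, g]) (u ^ g) = iter k (fun x => [~ x, g]) u ^ g.
Proof.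
elim: k => //= k ->.
by rewrite conjRg [g ^ g]conjgE mulKg.
Qed.

Lemma iter_comm1 (G : groupType) (k : nat) (g : G) :
  iter k (fun x => [~ x, g]) 1 = 1.
Proof. by elim: k => //= k ->; rewrite comm1g. Qed.

Lemma commgMr (G : groupType) (x y z : G) :
  [~ x, y * z] = [~ x, z] * [~ x, y] ^ z.
Proof. by rewrite !commgEl conjMg conjgM conjVg -mulgA mulVKg. Qed.

(* On the base group [[~ _, g]] is an endomorphism commuting with conjugation by
   [g], and [[~ u, g ^+ n]] is a product of conjugates of [[~ u, g]] by powers
   of [g]. *)
Lemma normal_iter_commX (N : set W) (k n : nat) (u g : W) : is_normal N ->
  wreath_top u = 1 -> N (iter k (fun x => [~ x, g]) u) ->
  N (iter k (fun x => [~ x, g ^+ n]) u).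
Proof.
move=> nN; elim: k u => [//|k IHk] u u1; rewrite !iterSr => Nu.
apply: IHk; first exact: wreath_topR.
elim: n => [|n IHn].
  by rewrite commg1 iter_comm1; exact: (subgroup1 nN).
rewrite expgSr commgMr iter_commM_base ?wreath_topJ ?wreath_topR //.
by apply: (subgroupM nN) => //; rewrite iter_commJ; exact: normalJ.
Qed.

(** * Test words of linear length *)

Definition comm_word (X : Type) (v w : word X) : word X :=
  inv_word v ++ inv_word w ++ v ++ w.

Definition iter_comm_word (X : Type) (m n : nat) (v w : word X) : word X :=
  iter m (fun x => comm_word x (flatten (nseq n w))) (flatten (nseq n v)).

Lemma word_class_iter_comm (X : choiceType) (m n : nat) (v w : word X) :
  word_class (iter_comm_word m n v w)
    = iter m (fun x => [~ x, word_class w ^+ n]) (word_class v ^+ n).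
Proof.
have power (x : word X) : word_class (flatten (nseq n x)) = word_class x ^+ n.
  by elim: n => //= n IHn; rewrite word_class_cat IHn expgS.
rewrite /iter_comm_word; elim: m => [|m IHm]; first exact: power.
by rewrite !iterS /comm_word !word_class_cat !word_class_inv IHm power.
Qed.

(** Each commutator doubles the length and adds a fixed multiple of [n]; the number [m] of
    commutators does not vary with [n]. *)
Lemma size_iter_comm_word (X : Type) (m : nat) (v w : word X) :
  exists L, forall n, size (iter_comm_word m n v w) = (L * n)%N.
Proof.
have power n (x : word X) : size (flatten (nseq n x)) = (size x * n)%N.
  by rewrite size_flatten /shape map_nseq sumn_nseq.
elim: m => [|m [L IHL]]; first by exists (size v) => n; exact: power.
exists (2 * (L + size w))%N => n.
rewrite /iter_comm_word iterS -/(iter_comm_word m n v w) /comm_word.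
rewrite !size_cat /inv_word !size_rev !size_map IHL power; lia.
Qed.

(** * The test elements: membership in the normal closure and top moment *)

Lemma cyclic_genX (n : nat) : cyclic_gen ^+ n = n%:R%R.
Proof. by elim: n => // n IHn; rewrite expgS IHn GRing.mulrS. Qed.

Lemma wreath_topX (u : W) (n : nat) : wreath_top (u ^+ n) = wreath_top u ^+ n.
Proof. by elim: n => // n IHn; rewrite !expgS wreath_topM IHn. Qed.

Lemma momentX (p : {poly int}) (u : W) (n : nat) : wreath_top u = 1 ->
  moment p (u ^+ n) = (moment p u *+ n)%R.
Proof.
move=> u1; elim: n => [|n IHn].
  by rewrite -[RHS](GRing.subrr (moment p u)) -momentV // -momentM // mulgV.
by rewrite expgS momentM // IHn GRing.mulrS.
Qed.

Lemma iter_comm_normal_closure (m n : nat) :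
  normal_closure [set w_ m.+1]
    (iter m (fun x => [~ x, W_t ^+ n]) (W_a ^+ n)).
Proof.
have nN := normal_closure_is_normal [set w_ m.+1].
have aX1 k : wreath_top (W_a ^+ k) = 1 by rewrite wreath_topX expg1n.
(* This replaces [W_t ^+ n] by [W_t]; additivity on the base then reduces [W_a ^+ n] to [W_a], which
   yields [w_ m.+1]. *)
apply: (normal_iter_commX _ nN) => //; elim: n => [|n IHn].
  by rewrite iter_comm1; exact: (subgroup1 nN).
rewrite expgS iter_commM_base //; apply: (subgroupM nN) => //.
by move=> N _; apply.
Qed.

(** General [c] and [z] are allowed because the lifts to [W] used later agree with [W_a] and [W_t]
    only modulo the normal closure of [w_ m.+1]. *)
Lemma moment_iter_comm (m n : nat) (c z : W) :
  wreath_top c = 1 -> moment 1%R c = 1%R -> wreath_top z = cyclic_gen ->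
  moment 'X^m%R (iter m (fun x => [~ x, z ^+ n]) (c ^+ n))
    = (n ^ m.+1 * m`!)%N%:R%R.
Proof.
move=> c1 mc z1.
have cX1 : wreath_top (c ^+ n) = 1 by rewrite wreath_topX c1 expg1n.
rewrite moment_iterR // wreath_topX z1 cyclic_genX.
rewrite iter_poly_diff ?size_polyXn // coefXn eqxx GRing.mulr1.
set b := (_ *+ m`!)%R.
have -> : moment b%:P%R (c ^+ n) = (b * moment 1 (c ^+ n))%R.
  rewrite /moment GRing.mulr_sumr; apply: eq_bigr => x _.
  by rewrite !hornerE GRing.mulrC; exact/esym/GRing.mulr1.
rewrite momentX // mc /b -GRing.natrX -GRing.mulrnA -GRing.natrM.
by rewrite expnSr mulnAC.
Qed.

Lemma moment1_a : moment 1%R W_a = 1%R.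
Proof.
have aS : (finsupp (wreath_base W_a) `<=` [fset 1])%fset.
  by apply/fsubsetP => x; rewrite mem_finsupp fsfunE; case: ifP; rewrite ?eqxx.
rewrite (moment_sub _ aS) big_seq_fset1 fsfunE in_fset1 eqxx hornerC.
exact: GRing.mulr1.
Qed.

Lemma morph_iter_comm (G E : groupType) (f : G -> E) (m n : nat) (x g : G) :
    {morph f : x y / x * y} ->
  f (iter m (fun y => [~ y, g ^+ n]) (x ^+ n))
    = iter m (fun y => [~ y, f g ^+ n]) (f x ^+ n).
Proof.
move=> fM; have fX y : f (y ^+ n) = f y ^+ n.
  by elim: n => [|n IHn]; rewrite ?(morphg1 fM) // !expgS fM IHn.
elim: m => [|m IHm]; first exact: fX.
by rewrite !iterS /commg /conjg !fM !(morphgV fM) IHm fX.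
Qed.

(** * Growth of the relative Dehn function of [H_ l] *)

Theorem corollary5p3 (l : nat) (hl : (1 <= l)%N) (P : rel_presentation (H_ l)) :
  dominated (fun n : nat => (n ^ l)%N) (rel_dehn P).
Proof.
case: l hl P => [//|m] _; case: (posnP m) => [->|m0] P.
  (* For [l = 1] the linear term in [dominated] suffices. *)
  by exists 1%N => // n; rewrite expn1; lia.
pose N := nclosure [set w_ m.+1].
have pM : {morph proj P : x y / x * y} by exact: gmulfM.
(* Lifts to [W] of the images of the generators; since [W] is metabelian, they extend to a morphism
   [Phi] covering [proj P]. *)
pose u (x : gens P) : W := repr (proj P (word_class [:: (x, false)])).
pose Phi := metabelian_eval u.
have PhiM : {morph Phi : x y / x * y}.
  exact: metabelian_evalM wreath_metabelian.
have coset_eval w : coset N (word_eval u w) = proj P (word_class w).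
  rewrite word_class_eval !morph_word_eval //; last exact: cosetM.
  by rewrite /word_eval; apply: eq_bigr => -[x b] _ /=; rewrite repr_cosetK.
(* [Phi] sends the kernel of [proj P] into the normal closure of [w_ m.+1]. *)
have low z : proj P z = 1 -> low_moments m (Phi z).
  have [w ->] := word_class_surj z; rewrite /Phi metabelian_evalE; last first.
    exact: wreath_metabelian.
  rewrite -coset_eval => /esym w1; apply: normal_closure_low_moments.
  have : coset N 1 = coset N (word_eval u w) by exact: w1.
  by move/coset_eqP; rewrite invg1 mul1g.
pose f z := moment 'X^m%R (Phi z).
have lift (g : W) : exists w, proj P (word_class w) = coset N g.
  have [z zg] := proj_surj P (coset N g); have [w wz] := word_class_surj z.
  by exists w; rewrite -wz.
have [[v va] [w wt]] := (lift W_a, lift W_t).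
have lift_low y g : proj P (word_class y) = coset N g ->
    low_moments m (g^-1 * Phi (word_class y)).
  move=> yg; apply: normal_closure_low_moments.
  apply/(@coset_eqP _ N).
  by rewrite -yg -coset_eval /Phi metabelian_evalE //; exact: wreath_metabelian.
have [[vt vm] [wt1 _]] := (lift_low _ _ va, lift_low _ _ wt).
have [L sizeL] := size_iter_comm_word m v w.
pose M := (\max_(r <- rels P) `|f r|)%N.
(* [M] bounds [f] on the relators and [L * n] is the length of the test word; the successor makes
   the constant positive. *)
exists (M + L).+1%N => // n.
set x := iter_comm_word m n v w.
have x1 : proj P (word_class x) = 1.
  rewrite word_class_iter_comm morph_iter_comm // va wt.
  rewrite -morph_iter_comm; last exact: cosetM.
  apply/esym/(@coset_eqP _ N 1); rewrite invg1 mul1g.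
  exact: iter_comm_normal_closure.
have fx : f (word_class x) = (n ^ m.+1 * m`!)%N%:R%R.
  rewrite /f word_class_iter_comm morph_iter_comm //.
  have top g h : wreath_top (g^-1 * h) = 1 -> wreath_top h = wreath_top g.
    by rewrite wreath_topM wreath_topV => /(canRL (mulVKg _)); rewrite mulg1.
  apply: moment_iter_comm; [exact: top vt | | exact: top wt1].
  (* As [m] is positive, the constant polynomial 1 has size at most [m], so the lift of [W_a] has
     the same moment against it as [W_a]. *)
  have := vm 1%R; rewrite momentM ?momentV // size_poly1 => /(_ m0).
  by rewrite moment1_a GRing.addrC => /GRing.subr0_eq.
have xM : (`|f (word_class x)| <= M * rel_area x)%N.
  apply: rel_area_ge => // [y z y1 z1|y g y1|r rR].
  - by rewrite /f PhiM momentM //; case: (low _ y1).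
  - rewrite /f -(momentJ_low (Phi g) _ (low _ y1)) ?size_polyXn //.
    by congr (moment _ _); rewrite /conjg !PhiM (morphgV PhiM).
  - exact: (leq_bigmax_seq (F := fun r => `|f r|%N)).
have xD : (rel_area x <= rel_dehn P ((M + L).+1 * n))%N.
  by apply: rel_area_le_dehn => //; rewrite sizeL; nia.
have n_le : (n ^ m.+1 <= `|f (word_class x)|)%N.
  by rewrite fx; have := fact_gt0 m; nia.
nia.
Qed.
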